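(* Let $A$ be an idiom and let $\zeta$ be the Goldie's nucleus on $A$. The following conditions are equivalent: (1) $A$ has finite uniform dimension; (2) $\mathcal{Q}_\zeta(A)$ is semisimple finite.
   Context: An idiom is a complete lattice $A$ (least element $0$, greatest element $1$) that is modular, i.e. $a\le b$ implies $(a\vee c)\wedge b=a\vee(c\wedge b)$, and upper continuous, i.e. $a\wedge\bigvee X=\bigvee\{a\wedge x\mid x\in X\}$ for all $a\in A$ and all directed $X\subseteq A$. For $a\le b$ in $A$, $[a,b]=\{x\in A\mid a\le x\le b\}$ is an interval. An element $x\in[a,b]$ is essential in $[a,b]$ if for every $y\in[a,b]$, $x\wedge y=a$ implies $y=a$. Two intervals $I,J$ are similar, $I\sim J$, if there are $l,r\in A$ such that one of $I,J$ is $[l,l\vee r]$ and the other is $[l\wedge r,r]$ (a reflexive and symmetric relation). An interval $[a,b]$ is nonsingular if whenever $a\le x\le b$ and $[c,d]\sim[a,x]$ with $c$ essential in $[0,d]$, then $c=d$. $\mathfrak{G}(A)$ is the set of nonsingular intervals of $A$. A nucleus on $A$ is a monotone map $j:A\to A$ with $a\le j(a)$, $j(a\wedge b)\ge j(a)\wedge j(b)$ and $j\circ j=j$; nuclei are ordered pointwise. For each interval $[a,b]$ there is a largest nucleus $\chi(a,b)$ with $\chi(a,b)(a)\wedge b=a$, and for a nucleus $j$, $\mathscr{F}_j=\{[a,b]\mid j\le\chi(a,b)\}$. The Goldie's nucleus $\zeta$ is the nucleus with $\mathscr{F}_\zeta=\mathfrak{G}(A)$. $A_\zeta=\{a\in A\mid\zeta(a)=a\}$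 is an idiom with the order of $A$, with the infima of $A$ and with suprema $\zeta(\bigvee X)$. The interval of quotients of an interval $[a,b]$ is the interval $\mathcal{Q}_\zeta([a,b])=[\zeta(a),\zeta(b)]$ of the idiom $A_\zeta$; in particular $\mathcal{Q}_\zeta(A)=\mathcal{Q}_\zeta([0,1])=A_\zeta$. In an idiom with least element $0$, a finite family $u_1,\dots,u_n$ is independent if $u_i\wedge\bigvee_{k\ne i}u_k=0$ for all $i$. An interval $[0,u]$ with $u\ne0$ is uniform if for all $x,y\le u$, $x\wedge y=0$ implies $x=0$ or $y=0$. $A$ has finite uniform dimension if there is a finite independent family $u_1,\dots,u_n$ in $A$ with each $[0,u_i]$ uniform and $\bigvee_i u_i$ essential in $[0,1]$. $A_\zeta$ is semisimple finite if its greatest element is the supremum, in $A_\zeta$, of a finite independent family of atoms of $A_\zeta$. *)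

(* Defs.v *)
From HB Require Import structures.
From mathcomp Require Import all_boot all_order.
From mathcomp Require Import boolp classical_sets.

Set Implicit Arguments.
Unset Strict Implicit.
Unset Printing Implicit Defensive.

Import Order.TTheory.
Local Open Scope classical_set_scope.
Local Open Scope order_scope.

(* Meaningful when X has a least upper bound, which holds for every X in an
   idiom; then Sup X is that bound (also for X = set0, where it is \bot). *)
Notation Sup X := (supremum \bot X).

Definition directed d (T : porderType d) (X : set T) : Prop :=
  X !=set0 /\
  forall x y, X x -> X y -> exists z, [/\ X z, x <= z & y <= z].

HB.mixin Record TBLattice_isIdiom d T of Order.TBLattice d T := {
  supremums_ex : forall X : set T, supremums X !=set0;
  idiom_modular : forall a b c : T,
    a <= b -> (a `|` c) `&` b = a `|` (c `&` b);
  idiom_upper_continuous : forall (a : T) (X : set T),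
    directed X -> a `&` Sup X = Sup [set a `&` x | x in X]
}.

#[short(type="idiomType")]
HB.structure Definition Idiom d :=
  { T of Order.TBLattice d T & TBLattice_isIdiom d T }.

Section Suprema.
Context {d : Order.disp_t} {A : idiomType d}.
Implicit Types (X : set A) (a x y : A).

Lemma Sup_supremums X : supremums X (Sup X).
Proof.
rewrite /supremum; case: ifPn => [/eqP ->|_].
  by split => [x []|x _]; exact: le0x.
by have [s hs] := supremums_ex X; case: xgetP => [y -> //|/(_ s)].
Qed.

Lemma Sup_ub X x : X x -> x <= Sup X.
Proof. by move=> Xx; have [h _] := Sup_supremums X; exact: h. Qed.

Lemma Sup_le X a : (forall x, X x -> x <= a) -> Sup X <= a.
Proof. by move=> h; have [_] := Sup_supremums X; apply; exact: h. Qed.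

End Suprema.

Section Intervals.
Context {d : Order.disp_t} {A : idiomType d}.

(* The interval [lo, hi] is represented by its endpoints, which determine and
   are determined by the set [lo, hi] since lo <= hi. *)
Record itvl := Itvl { lo : A; hi : A; lo_le_hi : lo <= hi }.

Definition itvl_set (I : itvl) : set A := [set x | lo I <= x <= hi I].

Definition itvl_full : itvl := Itvl (le0x \top).

Definition essential (I : itvl) (x : A) : Prop :=
  itvl_set I x /\ forall y, itvl_set I y -> x `&` y = lo I -> y = lo I.

Definition itvl_join (l r : A) : itvl := Itvl (leUl l r).
Definition itvl_meet (l r : A) : itvl := Itvl (leIr r l).

(* This is a single perspectivity step, not its transitive closure. *)
Definition similar (I J : itvl) : Prop :=
  exists l r, (I = itvl_join l r /\ J = itvl_meet l r) \/
              (J = itvl_join l r /\ I = itvl_meet l r).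

Definition nonsingular (I : itvl) : Prop :=
  forall (x : A) (ax : lo I <= x), x <= hi I ->
  forall J, similar J (Itvl ax) ->
    essential (Itvl (le0x (hi J))) (lo J) -> lo J = hi J.

Definition Gset : set itvl := [set I | nonsingular I].

End Intervals.
Arguments itvl {d} A.

Record nucleus d (A : idiomType d) := Nucleus {
  nuc_fun :> A -> A;
  nuc_mono : {homo nuc_fun : x y / x <= y};
  nuc_ge : forall a, a <= nuc_fun a;
  nuc_meet : forall a b, nuc_fun a `&` nuc_fun b <= nuc_fun (a `&` b);
  nuc_idem : forall a, nuc_fun (nuc_fun a) = nuc_fun a
}.

Section Chi.
Context {d : Order.disp_t} {A : idiomType d}.
Implicit Types (I : itvl A) (j k : nucleus A).

Definition nuc_le j k : Prop := forall x, j x <= k x.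

Lemma nucI j a b : j (a `&` b) = j a `&` j b.
Proof.
apply/eqP; rewrite eq_le nuc_meet andbT lexI.
by rewrite !nuc_mono // (leIl, leIr).
Qed.

Section Construction.
Variable I : itvl A.

(* The maps satisfying every condition on a nucleus j with
   j (lo I) `&` hi I = lo I, except idempotence. They are closed under
   composition, hence directed, and their pointwise supremum is idempotent. *)
Let pre (f : A -> A) : Prop :=
  [/\ {homo f : x y / x <= y}, (forall a, a <= f a),
      (forall a b, f a `&` f b <= f (a `&` b)) & f (lo I) `&` hi I = lo I].

Let pre_comp f g : pre f -> pre g -> pre (f \o g).
Proof.
move=> [fm fi fI fl] [gm gi gI gl]; split => /=.
- by move=> x y /gm/fm.
- by move=> a; apply: le_trans (gi a) (fi _).
- by move=> a b; apply: le_trans (fI _ _) (fm _ _ (gI _ _)).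
apply/eqP; rewrite eq_le; apply/andP; split; last first.
  by rewrite lexI lo_le_hi andbT (le_trans (gi _) (fi _)).
rewrite -[leRHS]fl lexI leIr andbT -[in leRHS]gl.
exact: le_trans (leI2 (lexx _) (fi _)) (fI _ _).
Qed.

Let psup (x : A) : A := Sup [set f x | f in pre].

Let pre_directed x : directed [set f x | f in pre].
Proof.
split.
  by exists x, id => //; split=> //; apply/meet_idPl/lo_le_hi.
move=> _ _ [f pf <-] [g pg <-]; exists (f (g x)).
have [fm fi _ _] := pf; have [_ gi _ _] := pg.
by split; [exists (f \o g) => //; exact: pre_comp | exact: fm | exact: fi].
Qed.

Let pre_psup : pre psup.
Proof.
split.
- move=> x y xy; apply: Sup_le => _ [f pf <-].
  have [fm _ _ _] := pf.
  by apply: le_trans (fm _ _ xy) _; apply: Sup_ub; exists f.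
- move=> a; apply: Sup_ub; exists id => //.
  by split=> //; apply/meet_idPl/lo_le_hi.
- move=> a b; rewrite idiom_upper_continuous; last exact: pre_directed.
  apply: Sup_le => _ [_ [g pg <-] <-].
  rewrite meetC idiom_upper_continuous; last exact: pre_directed.
  apply: Sup_le => _ [_ [f pf <-] <-].
  have [fm fi fI _] := pf; have [gm gi _ _] := pg.
  apply: (@le_trans _ _ (f (g (a `&` b)))); last first.
    by apply: Sup_ub; exists (f \o g) => //; exact: pre_comp.
  have [_ _ gI _] := pg.
  apply: le_trans (fm _ _ (gI _ _)); apply: le_trans (fI _ _).
  by rewrite meetC; apply: leI2; [exact: fm | exact: fi].
apply/eqP; rewrite eq_le; apply/andP; split; last first.
  rewrite lexI lo_le_hi andbT; apply: Sup_ub; exists id => //.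
  by split=> //; apply/meet_idPl/lo_le_hi.
rewrite meetC idiom_upper_continuous; last exact: pre_directed.
by apply: Sup_le => _ [_ [f [_ _ _ fl] <-] <-]; rewrite meetC fl.
Qed.

Let psup_idem a : psup (psup a) = psup a.
Proof.
apply/eqP; rewrite eq_le; apply/andP; split; last by case: pre_psup.
by apply: Sup_ub; exists (psup \o psup) => //; exact: pre_comp.
Qed.

Let psup_mono : {homo psup : x y / x <= y}. Proof. by case: pre_psup. Qed.
Let psup_ge a : a <= psup a. Proof. by case: pre_psup. Qed.
Let psup_meet a b : psup a `&` psup b <= psup (a `&` b).
Proof. by case: pre_psup. Qed.

Definition chi : nucleus A := Nucleus psup_mono psup_ge psup_meet psup_idem.

Lemma chi_lo : chi (lo I) `&` hi I = lo I.
Proof. by case: pre_psup. Qed.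

Lemma chi_largest j : j (lo I) `&` hi I = lo I -> nuc_le j chi.
Proof.
move=> jl x; apply: Sup_ub; exists (j : A -> A) => //.
split=> //; first exact: nuc_mono; first exact: nuc_ge.
exact: nuc_meet.
Qed.

End Construction.

Definition Fset j : set (itvl A) := [set I | nuc_le j (chi I)].

Definition is_goldie_nucleus j : Prop := Fset j = Gset.

End Chi.

(* The idiom A_j. *)
Section FixedPoints.
Context {d : Order.disp_t} {A : idiomType d} (j : nucleus A).

Definition fixedpts : Type := {x : A | j x == x}.

HB.instance Definition _ := SubChoice.on fixedpts.
HB.instance Definition _ :=
  Order.SubChoice_isSubPOrder.Build d A (fun x => j x == x) d fixedpts.

Implicit Types x y z : fixedpts.

Lemma fixedptsP x : j (val x) = val x. Proof. exact/eqP/(valP x). Qed.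

Lemma fix_leE x y : (x <= y) = (val x <= val y). Proof. by []. Qed.

Lemma fix_nuc_subproof (a : A) : j (j a) == j a.
Proof. by rewrite nuc_idem. Qed.
Definition fix_nuc (a : A) : fixedpts :=
  exist (fun b => j b == b) (j a) (fix_nuc_subproof a).

Lemma fix_nuc_le (a : A) y : (fix_nuc a <= y) = (a <= val y).
Proof.
rewrite fix_leE /=; apply/idP/idP; first exact: le_trans (nuc_ge _ _).
by move=> /(nuc_mono j); rewrite fixedptsP.
Qed.

Lemma fix_meet_subproof x y : j (val x `&` val y) == val x `&` val y.
Proof. by rewrite nucI !fixedptsP. Qed.
Definition fix_meet x y : fixedpts :=
  exist (fun a => j a == a) _ (fix_meet_subproof x y).
Definition fix_join x y : fixedpts := fix_nuc (val x `|` val y).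

Lemma fix_meetP x y z : (x <= fix_meet y z) = (x <= y) && (x <= z).
Proof. by rewrite !fix_leE /= lexI. Qed.
Lemma fix_joinP x y z : (fix_join x y <= z) = (x <= z) && (y <= z).
Proof. by rewrite fix_nuc_le leUx !fix_leE. Qed.

HB.instance Definition _ := Order.POrder_MeetJoin_isLattice.Build d fixedpts
  fix_meetP fix_joinP.

Lemma fix_bottomP x : fix_nuc \bot <= x.
Proof. by rewrite fix_nuc_le le0x. Qed.
Lemma fix_topP x : x <= fix_nuc \top.
Proof. by rewrite fix_leE /= (le_trans (lex1 _) (nuc_ge j _)). Qed.

HB.instance Definition _ := Order.hasBottom.Build d fixedpts fix_bottomP.
HB.instance Definition _ := Order.hasTop.Build d fixedpts fix_topP.

Lemma val_fix_meet x y : val (x `&` y) = val x `&` val y.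
Proof. by []. Qed.
Lemma val_fix_join x y : val (x `|` y) = j (val x `|` val y).
Proof. by []. Qed.

Lemma fix_supremums (X : set fixedpts) :
  supremums X (fix_nuc (Sup [set val x | x in X])).
Proof.
split=> [x Xx|y yX].
  rewrite fix_leE /=; apply: le_trans (nuc_ge _ _).
  by apply: Sup_ub; exists x.
rewrite fix_nuc_le; apply: Sup_le => _ [x Xx <-].
by rewrite -fix_leE; exact: yX.
Qed.

Lemma fix_SupE (X : set fixedpts) : Sup X = fix_nuc (Sup [set val x | x in X]).
Proof.
rewrite /supremum; case: ifPn => [/eqP ->|_].
  by rewrite image_set0 ifT //; apply/eqP.
case: xgetP => [y -> hy|/(_ _ (fix_supremums X)) //].
exact: (is_subset1_supremums hy (fix_supremums X)).
Qed.

Lemma fix_supremums_ex (X : set fixedpts) : supremums X !=set0.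
Proof. by exists (fix_nuc (Sup [set val x | x in X])); exact: fix_supremums. Qed.

Lemma fix_modular x y z : x <= y -> (x `|` z) `&` y = x `|` (z `&` y).
Proof.
move=> xy; apply: val_inj => /=.
by rewrite -{1}(fixedptsP y) -nucI idiom_modular.
Qed.

Lemma fix_upper_continuous x (X : set fixedpts) :
  directed X -> x `&` Sup X = Sup [set x `&` y | y in X].
Proof.
move=> [[x0 Xx0] dX]; rewrite !fix_SupE; apply: val_inj => /=.
rewrite -{1}(fixedptsP x) -nucI idiom_upper_continuous.
  by rewrite !image_comp.
split; first by exists (val x0), x0.
move=> _ _ [y Xy <-] [z Xz <-]; have [w [Xw yw zw]] := dX _ _ Xy Xz.
by exists (val w); split=> //; exists w.
Qed.

HB.instance Definition _ := TBLattice_isIdiom.Build d fixedpts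
  fix_supremums_ex fix_modular fix_upper_continuous.

End FixedPoints.

(* The interval [j lo, j hi] of the idiom A_j. *)
Section Quotients.
Context {d : Order.disp_t} {A : idiomType d} (j : nucleus A).

Lemma quot_itvl_subproof (I : itvl A) : fix_nuc j (lo I) <= fix_nuc j (hi I).
Proof. by rewrite fix_leE /= nuc_mono // lo_le_hi. Qed.

Definition quot_itvl (I : itvl A) : itvl (fixedpts j) :=
  Itvl (quot_itvl_subproof I).

Lemma quot_itvl_full : quot_itvl itvl_full = itvl_full.
Proof. by congr Itvl; exact: bool_irrelevance. Qed.

End Quotients.

Section Dimension.
Context {d : Order.disp_t} (A : idiomType d).

Definition independent n (u : 'I_n -> A) : Prop :=
  forall i, u i `&` \join_(k < n | k != i) u k = \bot.

Definition uniform (u : A) : Prop :=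
  u <> \bot /\
  forall x y, x <= u -> y <= u -> x `&` y = \bot -> x = \bot \/ y = \bot.

Definition atom (a : A) : Prop :=
  a <> \bot /\ forall x, x <= a -> x = \bot \/ x = a.

(* n = 0 is allowed: it is needed exactly when A is trivial (\bot = \top). *)
Definition finite_uniform_dim : Prop :=
  exists n (u : 'I_n -> A),
    [/\ independent u, forall i, uniform (u i)
      & essential itvl_full (\join_(i < n) u i)].

Definition semisimple_finite : Prop :=
  exists n (u : 'I_n -> A),
    [/\ independent u, forall i, atom (u i) & \top = \join_(i < n) u i].

End Dimension.

(* Main.v *)
Require Import Defs.
From mathcomp Require Import all_boot all_order.
From mathcomp Require Import boolp.

(** An interval [[0, x]] is always nonsingular, because a perspective image
    [[c, d]] of it with [c] essential in [[0, d]] is trivial; hence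
    [zeta 0 = 0].  Together with the nonsingularity of [[zeta x, 1]], this makes
    [zeta x] the largest element in which [x] is essential.  So [zeta] takes
    uniform elements to atoms of [A_zeta], preserves independence, and sends [x]
    to [1] exactly when [x] is essential in [A]. *)

Set Implicit Arguments.
Unset Strict Implicit.
Unset Printing Implicit Defensive.

Import Order.TTheory.
Local Open Scope order_scope.

Section FixNuc.
Context {d : Order.disp_t} {A : idiomType d} (j : nucleus A).

Lemma fix_nuc_val (x : fixedpts j) : fix_nuc j (val x) = x.
Proof. by apply: val_inj; rewrite /= fixedptsP. Qed.

(** [fix_nuc] is left adjoint to [val] ([fix_nuc_le]), so it preserves joins. *)
Lemma fix_nucU (a b : A) : fix_nuc j (a `|` b) = fix_nuc j a `|` fix_nuc j b.
Proof.
apply: le_anti; rewrite leUx !fix_nuc_le leUx -!fix_nuc_le leUl leUr /=.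
by rewrite !fix_nuc_le !(le_trans _ (nuc_ge j _)) ?leUl ?leUr.
Qed.

Lemma fix_nuc_bigjoin n (P : pred 'I_n) (u : 'I_n -> A) :
  fix_nuc j (\join_(i | P i) u i) = \join_(i | P i) fix_nuc j (u i).
Proof. exact: (big_morph (fix_nuc j) fix_nucU). Qed.

End FixNuc.

Lemma nonsingular_bottom d (A : idiomType d) (b : A) :
  nonsingular (Itvl (le0x b)).
Proof.
move=> x /= x_ge0 xb J [l [r [[-> eqI]|[eqI ->]]]] /= [/= _ ess].
  (* Here [J] is [[l, l \/ r]]: [r] is disjoint from the essential [l], hence zero. *)
  have lr0 : l `&` r = \bot by move: (congr1 lo eqI).
  have r0 : r = \bot by apply: ess; rewrite //= /itvl_set /= le0x leUr.
  by rewrite r0 joinx0.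
(* Here [J] is [[0, r]], and zero is essential below [r] only if [r] is zero. *)
have l0 : l = \bot by move: (congr1 lo eqI).
rewrite l0 meet0x in ess *; apply/esym/ess; last exact: meet0x.
by rewrite /itvl_set /= le0x lexx.
Qed.

Section GoldieNucleus.
Context {d : Order.disp_t} {A : idiomType d} {zeta : nucleus A}.
Hypothesis hzeta : is_goldie_nucleus zeta.

Lemma goldie_bottom : zeta \bot = \bot.
Proof.
have : Fset zeta (@itvl_full _ A) by rewrite hzeta; exact: nonsingular_bottom.
move=> /(_ \bot) zle; apply: le_anti; rewrite le0x andbT (le_trans zle) //.
by have := chi_lo (@itvl_full _ A); rewrite /= meetx1 => ->.
Qed.

Lemma goldie_disjoint (x y : A) :
  (zeta x `&` zeta y == \bot) = (x `&` y == \bot).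
Proof.
rewrite -nucI; apply/eqP/eqP => [z0|->]; last exact: goldie_bottom.
by apply: le_anti; rewrite le0x -[leRHS]z0 nuc_ge.
Qed.

Lemma goldie_eq0 (x : A) : zeta x = \bot -> x = \bot.
Proof. by move=> z0; apply: le_anti; rewrite le0x -[leRHS]z0 nuc_ge. Qed.

Lemma le_goldie (x y : A) : essential (Itvl (le0x y)) x -> y <= zeta x.
Proof.
move=> [/andP[/= _ xy] ess]; set z := zeta x.
have nonsing_z : nonsingular (Itvl (lex1 z)).
  rewrite -[nonsingular _]/(Gset _) -hzeta.
  (* [zeta] fixes [z], so it lies below [chi] of [[z, 1]]. *)
  by apply: chi_largest; rewrite /= meetx1 nuc_idem.
(* [[z /\ y, y]] is similar to [[z, z \/ y]], an initial part of [[z, 1]]; its lower end contains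
   [x], so it is essential below [y]. *)
have essJ : essential (Itvl (le0x y)) (z `&` y).
  split; first by rewrite /itvl_set /= le0x leIr.
  move=> w /= wy w0; apply: ess => //=; apply: le_anti.
  by rewrite le0x andbT -[leRHS]w0 leI2 // lexI nuc_ge.
suff <- : z `&` y = y by exact: leIl.
apply: (nonsing_z _ (leUl z y) (lex1 _) (itvl_meet z y)) => //.
by exists z, y; right.
Qed.

Lemma goldie_top (x : A) : zeta x = \top <-> essential itvl_full x.
Proof.
split=> [z1|/le_goldie]; last by rewrite le1x => /eqP.
split; first by rewrite /itvl_set /= le0x lex1.
move=> y _ /= /eqP; rewrite -goldie_disjoint z1 meet1x => /eqP.
exact: goldie_eq0.
Qed.

Lemma fix_nuc_eq0 (x : A) : fix_nuc zeta x = \bot <-> x = \bot.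
Proof.
split=> [/(congr1 val)|-> //]; rewrite /= goldie_bottom; exact: goldie_eq0.
Qed.

Lemma fix_nuc_eq1 (x : A) : fix_nuc zeta x = \top <-> essential itvl_full x.
Proof.
(* The top of [fixedpts zeta] has underlying value [zeta \top]. *)
have zeta1 : zeta \top = \top by apply/eqP; rewrite -le1x nuc_ge.
rewrite -goldie_top; split=> [/(congr1 val)|z1].
  by rewrite /= zeta1.
by apply: val_inj; rewrite /= z1 zeta1.
Qed.

Lemma fix_nuc_disjoint (x y : A) :
  fix_nuc zeta x `&` fix_nuc zeta y = \bot <-> x `&` y = \bot.
Proof.
rewrite -fix_nuc_eq0; suff -> : fix_nuc zeta (x `&` y) =
  fix_nuc zeta x `&` fix_nuc zeta y by [].
by apply: val_inj; rewrite /= nucI.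
Qed.

Lemma independent_fix_nuc n (u : 'I_n -> A) :
  independent (fun i => fix_nuc zeta (u i)) <-> independent u.
Proof.
by split=> ind i; have := ind i; rewrite -fix_nuc_bigjoin fix_nuc_disjoint.
Qed.

Lemma uniform_atom (u : A) : uniform u -> atom (fix_nuc zeta u).
Proof.
move=> [u0 unif]; split=> [/fix_nuc_eq0 //|x xu].
have [->|/eqP x0] := eqVneq x \bot; [by left | right].
apply: le_anti; rewrite xu fix_nuc_le.
(* By uniformity [val x /\ u] is essential below [u] unless it is zero, and then [x], being below
   the closure of [u], would vanish. *)
apply: le_trans (le_goldie _) (_ : zeta (val x `&` u) <= _); last first.
  by rewrite -[leRHS]fixedptsP nuc_mono ?leIl.
split; first by rewrite /itvl_set /= le0x leIr.
move=> y /andP[_ /= yu] xuy0.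
have [xu0|//] := unif _ _ (leIr _ _) yu xuy0.
case: x0; move/fix_nuc_disjoint: xu0.
by rewrite fix_nuc_val; move/meet_idPl: xu => ->.
Qed.

(** Disjoint elements have disjoint closures; below an atom these cannot both be the atom, so one is
    zero. *)
Lemma atom_uniform (u : fixedpts zeta) : atom u -> uniform (val u).
Proof.
move=> [u0 atom_u]; split=> [v0|x y xu yu].
  by apply: u0; rewrite -(fix_nuc_val u); exact/fix_nuc_eq0.
move=> /fix_nuc_disjoint.
have /atom_u[/fix_nuc_eq0 x0|->] : fix_nuc zeta x <= u by rewrite fix_nuc_le.
  by left.
have /atom_u[/fix_nuc_eq0 y0|->] : fix_nuc zeta y <= u by rewrite fix_nuc_le.
  by right.
by rewrite meetxx.
Qed.

End GoldieNucleus.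

Theorem theorem6p11 (d : Order.disp_t) (A : idiomType d) (zeta : nucleus A)
    (hzeta : is_goldie_nucleus zeta) :
  finite_uniform_dim A <-> semisimple_finite (fixedpts zeta).
Proof.
split=> [[n [u [ind unif ess]]]|[n [u [ind atoms top]]]].
  exists n, (fun i => fix_nuc zeta (u i)); split.
  - exact/(independent_fix_nuc hzeta).
  - by move=> i; exact: uniform_atom.
  - by rewrite -fix_nuc_bigjoin; apply/esym/(fix_nuc_eq1 hzeta).
exists n, (fun i => val (u i)); split.
- apply/(independent_fix_nuc hzeta).
  (* Joins of the [val (u i)] in [A] differ from those in [fixedpts zeta], but closing them gives
     back the family [u]. *)
  by under eq_fun do rewrite fix_nuc_val.
- by move=> i; exact: atom_uniform.
- apply/(fix_nuc_eq1 hzeta); rewrite fix_nuc_bigjoin top.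
  by apply: eq_bigr => i _; exact: fix_nuc_val.
Qed.
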